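(* The semirings $S_c^*(a)$ and $S_c^*(ab)$ are finitely based. Relative to the commutative ai-semiring laws, a basis for the identities of $S_c^*(ab)$ is $$x\preceq xy,\qquad y\preceq x^2,\qquad t\preceq xyz,\qquad xt\preceq xy+yz+zt.$$
   Context: An ai-semiring (additively idempotent semiring) is an algebra $(S,+,\cdot)$ with two binary operations such that $(S,+)$ is a commutative idempotent semigroup, $(S,\cdot)$ is a semigroup, and both distributive laws hold. The signature is $(+,\cdot)$, with no constants. The commutative ai-semiring laws are the ai-semiring axioms together with $xy\approx yx$. An algebra is finitely based if all its identities follow from some finite set of identities it satisfies. A set of identities is a basis for $S$ relative to the commutative ai-semiring laws if its members hold in $S$ and every identity of $S$ follows from them together with those laws. For terms $\mathbf u,\mathbf v$, the expression $\mathbf u\preceq\mathbf v$ denotes the identity $\mathbf u+\mathbf v\approx\mathbf v$. $S_c^*(a)=\{a,0\}$ and $S_c^*(ab)=\{a,b,ab,0\}$ with $a,b$ distinct letters. In each, $0$ is absorbing for both addition and multiplication, the nonzero elements are the nonempty square-free commutative words on the alphabet ($\{a\}$, respectively $\{a,b\}$), and for nonzero $u,v$: $u+v$ is the square-free word whose set of letters is the union of the sets of letters of $u$ and $v$; $u\cdot v$ is the square-free word $uv$ if $u$ and $v$ have no letter in common, and $u\cdot v=0$ otherwise. *)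

(* Defs.v *)
From Stdlib Require List.
From mathcomp Require Import all_boot.

Set Implicit Arguments.
Unset Strict Implicit.
Unset Printing Implicit Defensive.

Declare Scope term_scope.
Delimit Scope term_scope with term.

Record algebra := Algebra {
  carrier :> Type;
  add : carrier -> carrier -> carrier;
  mul : carrier -> carrier -> carrier
}.

Inductive term := Var of nat | Add of term & term | Mul of term & term.

Bind Scope term_scope with term.
Notation "s + t" := (Add s t) : term_scope.
Notation "s * t" := (Mul s t) : term_scope.

Fixpoint eval (S : algebra) (v : nat -> S) (t : term) : S :=
  match t with
  | Var n => v n
  | Add t1 t2 => add (eval v t1) (eval v t2)
  | Mul t1 t2 => mul (eval v t1) (eval v t2)
  end.

Fixpoint subst (s : nat -> term) (t : term) : term :=
  match t with
  | Var n => s n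
  | Add t1 t2 => Add (subst s t1) (subst s t2)
  | Mul t1 t2 => Mul (subst s t1) (subst s t2)
  end.

Record identity := Identity { lhs : term; rhs : term }.

Notation "s ≈ t" := (Identity s%term t%term) (at level 70, no associativity).
Notation "s ⪯ t" := (Identity (Add s%term t%term) t%term)
  (at level 70, no associativity).

Definition holds (S : algebra) (e : identity) : Prop :=
  forall v : nat -> S, eval v (lhs e) = eval v (rhs e).

(* Provability in Birkhoff's equational logic; by Birkhoff's completeness
   theorem this is the same as semantic consequence. *)
Inductive derives (E : seq identity) : term -> term -> Prop :=
  | derives_axiom e s :
      List.In e E -> derives E (subst s (lhs e)) (subst s (rhs e))
  | derives_refl t : derives E t t
  | derives_sym t u : derives E t u -> derives E u t
  | derives_trans t u w : derives E t u -> derives E u w -> derives E t w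
  | derives_add t t' u u' :
      derives E t t' -> derives E u u' -> derives E (t + u)%term (t' + u')%term
  | derives_mul t t' u u' :
      derives E t t' -> derives E u u' -> derives E (t * u)%term (t' * u')%term.

Definition follows (E : seq identity) (e : identity) : Prop :=
  derives E (lhs e) (rhs e).

Definition satisfies (S : algebra) (E : seq identity) : Prop :=
  forall e, List.In e E -> holds S e.

Definition finitely_based (S : algebra) : Prop :=
  exists E : seq identity,
    satisfies S E /\ forall e, holds S e -> follows E e.

Definition relative_basis (L : seq identity) (S : algebra) (E : seq identity) :
    Prop :=
  satisfies S E /\ forall e, holds S e -> follows (L ++ E) e.

Definition comm_ai_semiring_laws : seq identity :=
  let x := Var 0 in let y := Var 1 in let z := Var 2 in
  [:: (x + y) + z ≈ x + (y + z);
      x + y ≈ y + x;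
      x + x ≈ x;
      (x * y) * z ≈ x * (y * z);
      x * (y + z) ≈ x * y + x * z;
      (x + y) * z ≈ x * z + y * z;
      x * y ≈ y * x].

(* A square-free commutative word is identified with its set of letters. *)
Definition word (A : finType) := {w : {set A} | w != set0}.

Lemma word_union_subproof (A : finType) (u v : word A) :
  val u :|: val v != set0.
Proof. by rewrite setU_eq0 negb_and (valP u). Qed.

Definition word_union (A : finType) (u v : word A) : word A :=
  exist _ (val u :|: val v) (word_union_subproof u v).

(* None is the absorbing element 0. *)
Definition Sc_add (A : finType) (p q : option (word A)) : option (word A) :=
  match p, q with
  | Some u, Some v => Some (word_union u v)
  | _, _ => None
  end.

Definition Sc_mul (A : finType) (p q : option (word A)) : option (word A) :=
  match p, q with
  | Some u, Some v =>
      if [disjoint val u & val v] then Some (word_union u v) else None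
  | _, _ => None
  end.

(* S_c^* of the product of all letters of A, each occurring once. *)
Definition Sc (A : finType) : algebra :=
  @Algebra (option (word A)) (@Sc_add A) (@Sc_mul A).

Definition Sc_a : algebra := Sc 'I_1.
Definition Sc_ab : algebra := Sc 'I_2.

Section Laws.
Variable A : finType.
Implicit Types (u v w : word A) (p q r : option (word A)).

Lemma word_unionC u v : word_union u v = word_union v u.
Proof. by apply: val_inj; rewrite /= setUC. Qed.

Lemma word_unionA u v w :
  word_union u (word_union v w) = word_union (word_union u v) w.
Proof. by apply: val_inj; rewrite /= setUA. Qed.

Lemma word_unionuu u : word_union u u = u.
Proof. by apply: val_inj; rewrite /= setUid. Qed.

Lemma Sc_addC p q : Sc_add p q = Sc_add q p.
Proof. by case: p q => [u|] [v|] //=; rewrite word_unionC. Qed.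

Lemma Sc_addA p q r : Sc_add p (Sc_add q r) = Sc_add (Sc_add p q) r.
Proof. by case: p q r => [u|] [v|] [w|] //=; rewrite word_unionA. Qed.

Lemma Sc_addpp p : Sc_add p p = p.
Proof. by case: p => [u|] //=; rewrite word_unionuu. Qed.

Lemma Sc_mulC p q : Sc_mul p q = Sc_mul q p.
Proof.
by case: p q => [u|] [v|] //=; rewrite disjoint_sym word_unionC.
Qed.

Lemma disjoint_unionr (X Y Z : {set A}) :
  [disjoint X & Y :|: Z] = [disjoint X & Y] && [disjoint X & Z].
Proof. by rewrite -!setI_eq0 setIUr setU_eq0. Qed.

Lemma Sc_mulDr p q r :
  Sc_mul p (Sc_add q r) = Sc_add (Sc_mul p q) (Sc_mul p r).
Proof.
case: p q r => [u|] [v|] [w|] //=; last by case: ifP.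
rewrite disjoint_unionr.
case: [disjoint val u & val v]; case: [disjoint val u & val w] => //=.
by congr Some; apply: val_inj; rewrite /= setUUr.
Qed.

Lemma Sc_mulA p q r : Sc_mul p (Sc_mul q r) = Sc_mul (Sc_mul p q) r.
Proof.
have mul0 s : Sc_mul s None = None by case: s.
case: p q r => [u|] [v|] [w|] //=; rewrite ?mul0 //.
have fuse (X Y Z : {set A}) :
  [disjoint Y :|: Z & X] = [disjoint Y & X] && [disjoint Z & X].
  by rewrite disjoint_sym disjoint_unionr !(disjoint_sym X).
case vw: [disjoint val v & val w]; case uv: [disjoint val u & val v] => /=;
  rewrite ?disjoint_unionr ?fuse ?vw ?uv ?andbT ?andbF //=.
by rewrite word_unionA.
Qed.

Lemma Sc_comm_ai_semiring : satisfies (Sc A) comm_ai_semiring_laws.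
Proof.
move=> e /= He v; move: He; do ![case=> [<- /=|]] => //.
- by rewrite Sc_addA.
- exact: Sc_addC.
- exact: Sc_addpp.
- by rewrite Sc_mulA.
- exact: Sc_mulDr.
- by rewrite Sc_mulC Sc_mulDr !(Sc_mulC (v 2)).
- exact: Sc_mulC.
Qed.

End Laws.

(* Main.v *)
(* In S_c^*(ab) a product of two elements is nonzero only if the factors are {a}
   and {b} in some order, so the zero set of a term is governed by the proper
   2-colourings of the graph whose edges are its quadratic monomials; a term with
   a monomial of degree at least 3 is always 0.  An odd walk from x to t in the
   graph of s derives xt ⪯ s by iterating xt ⪯ xy + yz + zt.  If there is an odd
   closed walk then x^2 ⪯ s, so that s derivably dominates every term; otherwise
   two vertices not joined by an odd walk can be given the same colour.  Hence
   u ⪯ s is derivable as soon as u is nonzero wherever s is.  The same criterion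
   works for S_c^*(a), where all products are 0, with the single law z ⪯ xy. *)

Require Import Defs.
From Stdlib Require List.
From mathcomp Require Import all_boot.

Set Implicit Arguments.
Unset Strict Implicit.
Unset Printing Implicit Defensive.

Lemma In_cat (T : Type) (x : T) s1 s2 :
  List.In x (s1 ++ s2) <-> List.In x s1 \/ List.In x s2.
Proof. by elim: s1 => [|y s1 IH] /=; [|rewrite IH]; tauto. Qed.

(** * The derivable order on terms *)

Section TermOrder.

Variable E : seq identity.
Hypothesis lawsE : forall e, List.In e comm_ai_semiring_laws -> List.In e E.

Implicit Types t u w : term.

Definition inst (l : seq term) : nat -> term := nth (Var 0) l.

Definition le t u := derives E (t + u)%term u.

Lemma derives_addA t u w : derives E (t + u + w)%term (t + (u + w))%term.
Proof.
apply: (@derives_axiom E (Var 0 + Var 1 + Var 2 ≈ Var 0 + (Var 1 + Var 2))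
  (inst [:: t; u; w])); apply: lawsE => /=; tauto.
Qed.

Lemma derives_addC t u : derives E (t + u)%term (u + t)%term.
Proof.
apply: (@derives_axiom E (Var 0 + Var 1 ≈ Var 1 + Var 0) (inst [:: t; u])).
by apply: lawsE => /=; tauto.
Qed.

Lemma derives_addtt t : derives E (t + t)%term t.
Proof.
apply: (@derives_axiom E (Var 0 + Var 0 ≈ Var 0) (inst [:: t])).
by apply: lawsE => /=; tauto.
Qed.

Lemma derives_mulDl t u w : derives E ((t + u) * w)%term (t * w + u * w)%term.
Proof.
apply: (@derives_axiom E
  ((Var 0 + Var 1) * Var 2 ≈ Var 0 * Var 2 + Var 1 * Var 2)
  (inst [:: t; u; w])); apply: lawsE => /=; tauto.
Qed.

Lemma derives_mulC t u : derives E (t * u)%term (u * t)%term.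
Proof.
apply: (@derives_axiom E (Var 0 * Var 1 ≈ Var 1 * Var 0) (inst [:: t; u])).
by apply: lawsE => /=; tauto.
Qed.

Lemma derives_le t u : derives E t u -> le t u.
Proof.
move=> tu; apply: derives_trans (derives_addtt u).
exact: derives_add tu (derives_refl _ _).
Qed.

Lemma le_anti t u : le t u -> le u t -> derives E t u.
Proof.
move=> tu ut; apply: derives_trans (tu); apply: derives_trans (derives_addC u t).
exact: derives_sym.
Qed.

Lemma le_trans u t w : le t u -> le u w -> le t w.
Proof.
move=> tu uw; apply: derives_trans (uw).
apply: (derives_trans (u := (t + (u + w))%term)).
  exact: derives_add (derives_refl _ _) (derives_sym uw).
apply: derives_trans (derives_sym (derives_addA _ _ _)) _.
exact: derives_add tu (derives_refl _ _).
Qed.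

Lemma le_addl t u : le t (t + u)%term.
Proof.
apply: derives_trans (derives_sym (derives_addA _ _ _)) _.
exact: derives_add (derives_addtt t) (derives_refl _ _).
Qed.

Lemma le_addr t u : le u (t + u)%term.
Proof. exact: le_trans (le_addl u t) (derives_le (derives_addC u t)). Qed.

Lemma le_add t u w : le t w -> le u w -> le (t + u)%term w.
Proof.
move=> tw uw; apply: derives_trans (derives_addA _ _ _) _.
exact: derives_trans (derives_add (derives_refl _ _) uw) tw.
Qed.

Lemma le_mul t t' u u' : le t t' -> le u u' -> le (t * u)%term (t' * u')%term.
Proof.
have lemul2r a b w : le a b -> le (a * w)%term (b * w)%term.
  move=> ab; apply: derives_trans (derives_sym (derives_mulDl _ _ _)) _.
  exact: derives_mul ab (derives_refl _ _).
move=> tt' uu'; apply: le_trans (lemul2r _ _ u tt') _.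
apply: le_trans (derives_le (derives_mulC _ _)) _.
by apply: le_trans (lemul2r _ _ _ uu') (derives_le (derives_mulC _ _)).
Qed.

End TermOrder.

Arguments le E t u : clear implicits.

(** * Degrees of terms and the graph of a term *)

Fixpoint vars (t : term) : seq nat :=
  match t with
  | Var n => [:: n]
  | Add t1 t2 | Mul t1 t2 => vars t1 ++ vars t2
  end.

Fixpoint linear (t : term) : bool :=
  match t with
  | Var _ => true
  | Add t1 t2 => linear t1 && linear t2
  | Mul _ _ => false
  end.

Fixpoint quadratic (t : term) : bool :=
  match t with
  | Var _ => true
  | Add t1 t2 => quadratic t1 && quadratic t2
  | Mul t1 t2 => linear t1 && linear t2
  end.

(* On non-quadratic terms this also returns pairs of variables that do not form
   a monomial. *)
Fixpoint edges (t : term) : seq (nat * nat) :=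
  match t with
  | Var _ => [::]
  | Add t1 t2 => edges t1 ++ edges t2
  | Mul t1 t2 => [seq (x, y) | x <- vars t1, y <- vars t2]
  end.

Lemma edges_vars t x y : (x, y) \in edges t -> x \in vars t /\ y \in vars t.
Proof.
elim: t => [n|t1 IH1 t2 IH2|t1 _ t2 _] //=.
  by rewrite !mem_cat => /orP[/IH1|/IH2] [-> ->]; rewrite ?orbT.
by case/allpairsP=> -[a b] /= [? ? [-> ->]]; rewrite !mem_cat; split;
  apply/orP; [left|right].
Qed.

Section NonlinearTerms.

Variable E : seq identity.
Hypothesis lawsE : forall e, List.In e comm_ai_semiring_laws -> List.In e E.

Lemma linear_or_ge_mul2 t :
  linear t \/ exists a b, le E (a * b)%term t.
Proof.
elim: t => [n|t1 IH1 t2 IH2|t1 _ t2 _]; first by left.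
  case: IH1 => [l1|[a [b ab]]].
    case: IH2 => [l2|[a [b ab]]]; first by left; rewrite /= l1.
    right; exists a, b; apply: (le_trans lawsE ab); exact: le_addr.
  right; exists a, b; apply: (le_trans lawsE ab); exact: le_addl.
right; exists t1, t2; apply: derives_le => //; exact: derives_refl.
Qed.

(** A product fails to be quadratic only if one factor is nonlinear; that factor lies above some
    [a * b], and monotonicity of multiplication supplies the third factor. *)
Lemma quadratic_or_ge_mul3 t :
  quadratic t \/ exists a b c, le E (a * b * c)%term t.
Proof.
have refl w : le E w w by apply: derives_le => //; exact: derives_refl.
elim: t => [n|t1 IH1 t2 IH2|t1 _ t2 _]; first by left.
  case: IH1 => [l1|[a [b [c abc]]]].
    case: IH2 => [l2|[a [b [c abc]]]]; first by left; rewrite /= l1.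
    right; exists a, b, c; apply: (le_trans lawsE abc); exact: le_addr.
  right; exists a, b, c; apply: (le_trans lawsE abc); exact: le_addl.
case: (linear_or_ge_mul2 t1) => [l1|[a [b ab]]]; last first.
  by right; exists a, b, t2; apply: le_mul.
case: (linear_or_ge_mul2 t2) => [l2|[a [b ab]]]; first by left; rewrite /= l1.
right; exists a, b, t1; apply: (le_trans lawsE (le_mul lawsE ab (refl t1))).
by apply: derives_le => //; exact: derives_mulC.
Qed.

End NonlinearTerms.

(** * Nonvanishing of term values *)

Definition nonzero (A : finType) (p : Sc A) : bool :=
  isSome (p : option (word A)).

Section Nonzero.

Variable A : finType.
Implicit Types (p q r : Sc A) (v : nat -> Sc A).

Lemma nonzero_add p q : nonzero (Sc_add p q) = nonzero p && nonzero q.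
Proof. by case: p q => [u|] [w|]. Qed.

Lemma nonzero_mulC p q : nonzero (Sc_mul p q) = nonzero (Sc_mul q p).
Proof. by rewrite Sc_mulC. Qed.

Lemma nonzero_mulDr p q r :
  nonzero (Sc_mul p (Sc_add q r)) = nonzero (Sc_mul p q) && nonzero (Sc_mul p r).
Proof. by rewrite -nonzero_add Sc_mulDr. Qed.

Lemma nonzero_mulDl p q r :
  nonzero (Sc_mul (Sc_add p q) r) = nonzero (Sc_mul p r) && nonzero (Sc_mul q r).
Proof. by rewrite !(nonzero_mulC _ r) nonzero_mulDr. Qed.

Lemma nonzero_linear v t :
  linear t -> {in vars t, forall n, nonzero (v n)} -> nonzero (eval v t).
Proof.
elim: t => [n|t1 IH1 t2 IH2|//] /=.
  by move=> _; apply; rewrite inE.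
case/andP=> l1 l2 nz; rewrite nonzero_add IH1 ?IH2 // => n nt;
  by apply: nz; rewrite mem_cat nt ?orbT.
Qed.

(** Distributivity expands the product into a sum of products of variables, and a sum is nonzero
    exactly when all its summands are. *)
Lemma nonzero_mul_linear v t1 t2 :
  linear t1 -> linear t2 ->
  (forall x y, x \in vars t1 -> y \in vars t2 -> nonzero (Sc_mul (v x) (v y))) ->
  nonzero (eval v (t1 * t2)%term).
Proof.
elim: t1 => [x|t11 IH1 t12 IH2|//] /=; last first.
  case/andP=> l1 l2 lt2 nz; rewrite nonzero_mulDl.
  by apply/andP; split; [apply: IH1|apply: IH2] => // x y xt yt;
    apply: nz; rewrite // mem_cat xt ?orbT.
move=> _; elim: t2 => [y|t21 IH1 t22 IH2|//] /=.
  by move=> _; apply; rewrite inE.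
case/andP=> l1 l2 nz; rewrite nonzero_mulDr.
by apply/andP; split; [apply: IH1|apply: IH2] => // z y zt yt;
  apply: nz; rewrite // mem_cat yt ?orbT.
Qed.

Lemma nonzero_quadratic v t :
  quadratic t -> {in vars t, forall n, nonzero (v n)} ->
  (forall x y, (x, y) \in edges t -> nonzero (Sc_mul (v x) (v y))) ->
  nonzero (eval v t).
Proof.
elim: t => [n|t1 IH1 t2 IH2|t1 _ t2 _].
- by move=> _ nz _; apply: nz; rewrite inE.
- case/andP=> q1 q2 nz nze /=; rewrite nonzero_add.
  apply/andP; split; [apply: IH1|apply: IH2] => // [n nt|x y xy|n nt|x y xy];
    by [apply: nz; rewrite /= mem_cat nt ?orbT
       |apply: nze; rewrite /= mem_cat xy ?orbT].
case/andP=> l1 l2 _ nze; apply: nonzero_mul_linear => // x y xt yt.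
by apply: nze; apply: allpairs_f.
Qed.

(** Reduces completeness to a comparison of zero sets: the sides of a valid identity vanish
    together, so each is derivably below the other, and [le_anti] applies. *)
Lemma complete_of_nonzero (E : seq identity) :
    (forall e, List.In e comm_ai_semiring_laws -> List.In e E) ->
    (forall u s,
      (forall v, nonzero (eval v s) -> nonzero (eval v u)) -> le E u s) ->
  forall e, holds (Sc A) e -> follows E e.
Proof.
move=> lawsE H [t u] tu.
have {}tu v : eval v t = eval v u by exact: tu.
by apply: le_anti => //; apply: H => v; rewrite tu.
Qed.

End Nonzero.

Lemma set1_neq0 (A : finType) (a : A) : [set a] != set0.
Proof. by apply/set0Pn; exists a; rewrite inE. Qed.

Definition letter (A : finType) (a : A) : Sc A :=
  Some (exist (fun w : {set A} => w != set0) [set a] (set1_neq0 a)).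

(** * The semiring on one letter *)

Lemma Sc_a_mul (p q : Sc_a) : Sc_mul p q = None.
Proof.
case: p q => [[X X0]|] [[Y Y0]|] //=; case: ifP => // dXY.
have [[x xX] [y yY]] := (set0Pn _ X0, set0Pn _ Y0).
by have := disjointFr dXY xX; rewrite (ord1 x) -(ord1 y) yY.
Qed.

Definition Sc_a_basis : seq identity :=
  comm_ai_semiring_laws ++ [:: Var 2 ⪯ Var 0 * Var 1].

Lemma Sc_a_basis_laws e :
  List.In e comm_ai_semiring_laws -> List.In e Sc_a_basis.
Proof. by move=> He; apply/In_cat; left. Qed.

Lemma le_Sc_a u s :
    (forall v : nat -> Sc_a, nonzero (eval v s) -> nonzero (eval v u)) ->
  le Sc_a_basis u s.
Proof.
have lawsE := Sc_a_basis_laws.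
case: (linear_or_ge_mul2 lawsE s) => [ls|[a [b ab]] _]; last first.
  apply: le_trans ab => //.
  apply: (@derives_axiom Sc_a_basis (Var 2 ⪯ Var 0 * Var 1)
    (inst [:: a; b; u])).
  by apply/In_cat; right; left.
pose a : Sc_a := letter ord0.
elim: u => [x|u1 IH1 u2 IH2|u1 _ u2 _] H; last first.
(* The linear term [s] is nonzero at the constant valuation [a], whereas a product is always 0. *)
- have /H : nonzero (eval (fun=> a) s) by apply: nonzero_linear.
  by rewrite /= /nonzero Sc_a_mul.
- by apply: le_add => //; [apply: IH1|apply: IH2] => v /H /=;
    rewrite nonzero_add => /andP[].
have [xs|xs] := boolP (x \in vars s).
  elim: s ls xs {H} => [n|s1 IH1 s2 IH2|//] /=.
    rewrite inE => _ /eqP->; apply: derives_le => //; exact: derives_refl.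
  case/andP=> l1 l2; rewrite mem_cat => /orP[xs|xs].
    by apply: (le_trans lawsE (IH1 l1 xs)); exact: le_addl.
  by apply: (le_trans lawsE (IH2 l2 xs)); exact: le_addr.
(* Vanishing at [x] alone, this valuation kills [x] but not [s], in which [x] does not occur. *)
pose v n : Sc_a := if n == x then None else a.
have /H : nonzero (eval v s).
  apply: nonzero_linear => // n ns; rewrite /v.
  by case: eqP => // nx; rewrite -nx ns in xs.
by rewrite /= /v eqxx.
Qed.

Lemma Sc_a_finitely_based : finitely_based Sc_a.
Proof.
exists Sc_a_basis; split; last first.
  exact: complete_of_nonzero Sc_a_basis_laws le_Sc_a.
move=> e /In_cat[|[<- v|//]]; first exact: Sc_comm_ai_semiring.
by rewrite /= !Sc_a_mul; case: (v 2).
Qed.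

(** * Two-colourings of graphs without odd closed walks *)

Section TwoColouring.

Variables (T : finType) (e : rel T).
Hypothesis e_sym : symmetric e.

(* Paths from (i, b) to (j, c) are the walks from i to j whose length has the
   parity of b + c. *)
Definition double_cover : rel (T * bool) :=
  fun p q => e p.1 q.1 && (p.2 != q.2).

Lemma double_cover_sym : connect_sym double_cover.
Proof.
by apply: sym_connect_sym => p q; rewrite /double_cover e_sym eq_sym.
Qed.

Lemma two_colouring (x y : T) :
    (forall i, ~~ connect double_cover (i, true) (i, false)) ->
    ~~ connect double_cover (x, true) (y, false) ->
  exists c : T -> bool, (forall i j, e i j -> c i != c j) /\ c x = c y.
Proof.
move=> odd_free xy.
pose r i b := enum_rank (root double_cover (i, b)).
have rE i b j c : (r i b == r j c) = connect double_cover (i, b) (j, c).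
  by rewrite (inj_eq enum_rank_inj) (root_connect double_cover_sym).
have re i j b : e i j -> r i b = r j (~~ b).
  move=> ij; apply/eqP; rewrite rE; apply: connect1.
  by rewrite /double_cover /= ij; case: b.
have r_neq i : r i true != r i false by rewrite rE.
(* The two lifts of i to the double cover lie in distinct components; colouring
   i by the order of their representatives is proper, and it can be changed
   freely on the component of x. *)
pose c0 i := (r i true < r i false)%N.
have c0e i j : e i j -> c0 j = ~~ c0 i.
  move=> ij; rewrite /c0 (re _ _ true ij) (re _ _ false ij) /= -leqNgt.
  by rewrite ltn_neqAle (inj_eq val_inj) r_neq.
(* [f] is the connected component of [x] in the graph itself: some walk of either parity reaches
   [x]. *)
pose f i := (r i true == r x true) || (r i false == r x true).
have fe i j : e i j -> f j = f i.
  by move=> ij; rewrite /f (re _ _ true ij) (re _ _ false ij) /= orbC.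
(* On that component exactly one lift of [i] is connected to [(x, true)]; which one it is gives the
   parity of the distance to [x], a proper colouring. *)
have rx i : f i -> (r i false == r x true) = (r i true != r x true).
  rewrite /f => /orP[/eqP<-|/eqP fi].
    by rewrite eqxx [LHS]eq_sym (negPf (r_neq i)).
  by rewrite fi eqxx -fi r_neq.
have fx : f x by rewrite /f eqxx.
(* [b] becomes the colour of [x]. If [y] is outside the component, it copies [c0 y]; if inside, any
   value would do, as [x] and [y] are then at even distance. *)
pose b := f y || c0 y.
exists (fun i => if f i then (r i true == r x true) == b else c0 i).
split=> [i j ij|]; last first.
  rewrite fx eqxx /b; have [/= fy|//] := boolP (f y).
  by case/orP: fy => [->//|/eqP yx]; move: xy; rewrite -rE yx eqxx.
rewrite (fe _ _ ij) (c0e _ _ ij) (re _ _ true (_ : e j i)) 1?[e j i]e_sym //=.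
have [fi|_] := ifP; last by case: (c0 i).
by rewrite (rx i fi); case: b; case: (r i true == r x true).
Qed.

End TwoColouring.

(** * Soundness of the four laws on two letters *)

Section SoundnessAb.

Implicit Types p q r t : Sc_ab.

(** [Y] lies in the complement of [X], which has at most one element. *)
Lemma disjoint_I2 (X Y : {set 'I_2}) :
  X != set0 -> Y != set0 -> [disjoint X & Y] -> Y = ~: X.
Proof.
rewrite -!card_gt0 => X0 Y0 XY; apply/eqP.
rewrite eqEcard -disjoints_subset disjoint_sym XY /=.
rewrite cardsCs setCK card_ord.
by apply: leq_trans Y0; rewrite leq_subLR addn1 ltnS.
Qed.

Lemma Sc_ab_mul3 p q r : Sc_mul (Sc_mul p q) r = None.
Proof.
case: p q r => [[X X0]|] [[Y Y0]|] [[Z Z0]|] //=; case: ifP => //= dXY.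
case: ifP => // dXYZ; exfalso; move: dXYZ (Z0).
rewrite (disjoint_I2 X0 Y0 dXY) setUCr -setI_eq0 setTI => /eqP->.
by rewrite eqxx.
Qed.

Lemma Sc_ab_mulpp p : Sc_mul p p = None.
Proof.
case: p => [[X X0]|] //=; case: ifP => // dXX; exfalso; move: dXX (X0).
by rewrite -setI_eq0 setIid => ->.
Qed.

Lemma Sc_mul_ge (A : finType) (p q : option (word A)) :
  Sc_add p (Sc_mul p q) = Sc_mul p q.
Proof.
case: p q => [u|] [w|] //=; case: ifP => // _.
by rewrite word_unionA word_unionuu.
Qed.

(** If the three products on the right are nonzero, each word is the complement of the previous one,
    so [p] and [t] are complementary too and both sides are the full word. *)
Lemma Sc_ab_walk p q r t :
  Sc_add (Sc_mul p t) (Sc_add (Sc_add (Sc_mul p q) (Sc_mul q r)) (Sc_mul r t)) =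
  Sc_add (Sc_add (Sc_mul p q) (Sc_mul q r)) (Sc_mul r t).
Proof.
have add0 s : Sc_add s None = None by case: s.
case: p q r t => [[X X0]|] [[Y Y0]|] [[Z Z0]|] [[T T0]|] //=;
  rewrite ?add0 //.
case: ifP => XT; case: ifP => XY; case: ifP => YZ; case: ifP => ZT //=;
  have YE := disjoint_I2 X0 Y0 XY; have ZE := disjoint_I2 Y0 Z0 YZ;
  have TE := disjoint_I2 Z0 T0 ZT.
  congr Some; apply/val_inj/setP=> i; rewrite /= TE ZE YE !inE.
  by case: (i \in X).
by exfalso; move: XT; rewrite TE ZE YE setCK disjoint_sym disjoints_subset subxx.
Qed.

End SoundnessAb.

Definition Sc_ab_axioms : seq identity :=
  let x := Var 0 in let y := Var 1 in let z := Var 2 in let t := Var 3 in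
  [:: x ⪯ x * y;
      y ⪯ x * x;
      t ⪯ x * y * z;
      x * t ⪯ x * y + y * z + z * t].

Definition Sc_ab_basis : seq identity := comm_ai_semiring_laws ++ Sc_ab_axioms.

Lemma Sc_ab_basis_laws e :
  List.In e comm_ai_semiring_laws -> List.In e Sc_ab_basis.
Proof. by move=> He; apply/In_cat; left. Qed.

Lemma Sc_ab_axioms_sound : satisfies Sc_ab Sc_ab_axioms.
Proof.
have add0 s : Sc_add s None = None :> Sc_ab by case: s.
move=> e /= He v; move: He; do ![case=> [<- /=|]] => //.
- exact: Sc_mul_ge.
- by rewrite Sc_ab_mulpp add0.
- by rewrite Sc_ab_mul3 add0.
- exact: Sc_ab_walk.
Qed.

(** * Completeness on two letters *)

Notation "t ⊑ u" := (le Sc_ab_basis t u) (at level 70, no associativity).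

Section CompletenessAb.

Let lawsE := Sc_ab_basis_laws.

Lemma ge_mul x y : x ⊑ (x * y)%term.
Proof.
apply: (@derives_axiom Sc_ab_basis (Var 0 ⪯ Var 0 * Var 1) (inst [:: x; y])).
by apply/In_cat; right; rewrite /=; tauto.
Qed.

Lemma ge_square x y : y ⊑ (x * x)%term.
Proof.
apply: (@derives_axiom Sc_ab_basis (Var 1 ⪯ Var 0 * Var 0) (inst [:: x; y])).
by apply/In_cat; right; rewrite /=; tauto.
Qed.

Lemma ge_mul3 x y z t : t ⊑ (x * y * z)%term.
Proof.
apply: (@derives_axiom Sc_ab_basis (Var 3 ⪯ Var 0 * Var 1 * Var 2)
  (inst [:: x; y; z; t])).
by apply/In_cat; right; rewrite /=; tauto.
Qed.

Lemma ge_walk3 x y z t s :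
  (x * y)%term ⊑ s -> (y * z)%term ⊑ s -> (z * t)%term ⊑ s -> (x * t)%term ⊑ s.
Proof.
move=> xy yz zt; apply: (le_trans lawsE) (_ : (x * y + y * z + z * t)%term ⊑ s).
  apply: (@derives_axiom Sc_ab_basis
    (Var 0 * Var 3 ⪯ Var 0 * Var 1 + Var 1 * Var 2 + Var 2 * Var 3)
    (inst [:: x; y; z; t])).
  by apply/In_cat; right; rewrite /=; tauto.
by apply: (le_add lawsE) => //; apply: (le_add lawsE).
Qed.

Lemma ge_mulC x y s : (x * y)%term ⊑ s -> (y * x)%term ⊑ s.
Proof.
by apply: (le_trans lawsE); apply: (derives_le lawsE); exact: derives_mulC.
Qed.

Lemma var_le x t : x \in vars t -> Var x ⊑ t.
Proof.
elim: t => [n|t1 IH1 t2 IH2|t1 IH1 t2 IH2] /=.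
- rewrite inE => /eqP->; apply: (derives_le lawsE); exact: derives_refl.
- rewrite mem_cat => /orP[/IH1|/IH2] xt; apply: (le_trans lawsE xt).
    exact: le_addl.
  exact: le_addr.
rewrite mem_cat => /orP[/IH1|/IH2] xt; apply: (le_trans lawsE xt).
  exact: ge_mul.
apply: (le_trans lawsE (ge_mul t2 t1)); apply: (derives_le lawsE).
exact: derives_mulC.
Qed.

(** Valid even for pairs that form no monomial: by [var_le] each factor of a product dominates its
    variables, and multiplication is monotone. *)
Lemma edge_le x y t : (x, y) \in edges t -> (Var x * Var y)%term ⊑ t.
Proof.
elim: t => [n|t1 IH1 t2 IH2|t1 _ t2 _] //=.
  rewrite mem_cat => /orP[/IH1|/IH2] xt; apply: (le_trans lawsE xt).
    exact: le_addl.
  exact: le_addr.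
case/allpairsP=> -[a b] /= [? ? [-> ->]].
by apply: (le_mul lawsE); apply: var_le.
Qed.

(** The graph is cut down to a finite vertex set so that [connect] applies. *)
Definition edge_rel (s : term) (N : nat) : rel 'I_N :=
  fun i j => ((val i, val j) \in edges s) || ((val j, val i) \in edges s).

Lemma edge_rel_sym s N : symmetric (@edge_rel s N).
Proof. by move=> i j; rewrite /edge_rel orbC. Qed.

Lemma edge_rel_le s N (i j : 'I_N) :
  edge_rel s i j -> (Var i * Var j)%term ⊑ s.
Proof. by case/orP=> /edge_le => [|/ge_mulC]. Qed.

Lemma odd_walk_le s N (i j : 'I_N) :
  connect (double_cover (@edge_rel s N)) (i, true) (j, false) ->
  (Var i * Var j)%term ⊑ s.
Proof.
(* Invariant along a walk from [i]. After an even number of steps there is no monomial to bound, so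
   the claim is made about every possible next step [t]; at the start it is trivial. *)
pose P (q : 'I_N * bool) := if q.2 then
    forall t, (Var q.1 * t)%term ⊑ s -> (Var i * t)%term ⊑ s
  else (Var i * Var q.1)%term ⊑ s.
suff H p q : connect (double_cover (@edge_rel s N)) p q -> P p -> P q.
  by move/H; apply.
case/connectP=> w + ->; elim: w p => [|p' w IH] p //= /andP[/andP[]].
move=> /edge_rel_le pp' neq /IH{}IH Pp; apply: IH.
case: p p' pp' neq Pp => [k b] [k' b']; rewrite /P /=; case: b; case: b' => //.
  by move=> kk' _ /(_ _ kk').
by move=> kk' _ ik t k't; apply: ge_walk3 ik kk' k't.
Qed.

(** The first case covers a monomial of degree at least 3 and an odd closed walk, the second an odd
    walk from [x] to [y]; otherwise [two_colouring] applies. *)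
Lemma dominates_or_colouring s x y :
  (forall t, t ⊑ s) \/ (Var x * Var y)%term ⊑ s \/
  exists c : nat -> bool,
    [/\ quadratic s, forall i j, (i, j) \in edges s -> c i != c j & c x = c y].
Proof.
case: (quadratic_or_ge_mul3 lawsE s) => [qs|[a [b [d abd]]]]; last first.
  by left=> t; apply: (le_trans lawsE (ge_mul3 a b d t)).
(* [N] bounds every relevant variable, so [inord] into ['I_N.+1] is faithful on them; what it does
   to larger numbers is immaterial. *)
pose N := \max_(n <- [:: x, y & vars s]) n.
have leN n : n \in [:: x, y & vars s] -> n <= N.
  by move=> nV; exact: (leq_bigmax_seq (F := id) n nV).
pose G := @edge_rel s N.+1.
have [[i ii]|odd_free] :=
    altP (@existsP _ (fun i => connect (double_cover G) (i, true) (i, false))).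
  left=> t; apply: (le_trans lawsE) (odd_walk_le ii); exact: ge_square.
rewrite negb_exists in odd_free; move/forallP: odd_free => odd_free.
have xN : x <= N by apply: leN; rewrite !inE eqxx.
have yN : y <= N by apply: leN; rewrite !inE eqxx orbT.
have [xy|xy] := boolP (connect (double_cover G) (inord x, true) (inord y, false)).
  by right; left; have := odd_walk_le xy; rewrite !inordK.
have [c [cG cxy]] := two_colouring (@edge_rel_sym s N.+1) odd_free xy.
right; right; exists (fun n => c (inord n)); split=> // i j ij; apply: cG.
have [si sj] := edges_vars ij.
by rewrite /edge_rel /= !inordK ?ij // ltnS; apply: leN;
  rewrite !inE ?si ?sj !orbT.
Qed.

Definition colour_val (b : bool) : Sc_ab :=
  letter (if b then ord0 else ord_max).

Lemma nonzero_mul_colour b c :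
  nonzero (Sc_mul (colour_val b) (colour_val c)) = (b != c).
Proof.
rewrite /nonzero /=; case: ifP => /=; rewrite disjoints1 !inE;
  by case: b; case: c.
Qed.

Lemma le_Sc_ab u s :
    (forall v : nat -> Sc_ab, nonzero (eval v s) -> nonzero (eval v u)) ->
  u ⊑ s.
Proof.
have nz (c : nat -> bool) : quadratic s ->
    (forall i j, (i, j) \in edges s -> c i != c j) ->
    nonzero (eval (fun n => colour_val (c n)) s).
  move=> qs cs; apply: nonzero_quadratic => // i j ij.
  by rewrite nonzero_mul_colour; apply: cs.
(* For equal vertices the middle case of [dominates_or_colouring] puts a square below [s], which
   then dominates everything. *)
have [dom //|[c qs cs]] : (forall t, t ⊑ s) \/ exists2 c : nat -> bool,
    quadratic s & forall i j, (i, j) \in edges s -> c i != c j.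
  have [|[sq|[c [qs cs _]]]] := dominates_or_colouring s 0 0; first by left.
    by left=> t; apply: (le_trans lawsE) sq; exact: ge_square.
  by right; exists c.
elim: u => [x|u1 IH1 u2 IH2|u1 _ u2 _] H.
- have [/var_le //|xs] := boolP (x \in vars s).
  pose v n : Sc_ab := if n == x then None else colour_val (c n).
  have vE n : n \in vars s -> v n = colour_val (c n).
    by move=> ns; rewrite /v; case: eqP => // nx; rewrite -nx ns in xs.
  have /H : nonzero (eval v s).
    apply: nonzero_quadratic => // [n ns|i j ij]; first by rewrite vE.
    have [si sj] := edges_vars ij.
    by rewrite !vE // nonzero_mul_colour; apply: cs.
  by rewrite /= /v eqxx.
- by apply: (le_add lawsE); [apply: IH1|apply: IH2] => v /H /=;
    rewrite nonzero_add => /andP[].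
(* Sums in the factors are distributed away, and a product inside a factor makes [u] vanish where
   [s] does not; only products of two variables remain. *)
elim: u1 H => [x|u11 IH1 u12 IH2|u11 _ u12 _] H; last first.
- by have := H _ (nz c qs cs); rewrite /= /nonzero Sc_ab_mul3.
- apply: (le_trans lawsE (derives_le lawsE (derives_mulDl lawsE _ _ _))).
  by apply: (le_add lawsE); [apply: IH1|apply: IH2] => v /H /=;
    rewrite nonzero_mulDl => /andP[].
elim: u2 H => [y|u21 IH1 u22 IH2|u21 _ u22 _] H; last first.
- by have := H _ (nz c qs cs); rewrite /nonzero [eval _ _]Sc_mulC Sc_ab_mul3.
- apply: (le_trans lawsE (derives_le lawsE (derives_mulC lawsE _ _))).
  apply: (le_trans lawsE (derives_le lawsE (derives_mulDl lawsE _ _ _))).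
  by apply: (le_add lawsE); apply: ge_mulC; [apply: IH1|apply: IH2] => v /H /=;
    rewrite nonzero_mulDr => /andP[].
(* A colouring with [d x = d y] would give [x] and [y] the same letter, making their product 0 while
   [s] stays nonzero. *)
have [//|[//|[d [_ ds dxy]]]] := dominates_or_colouring s x y.
by have := H _ (nz d qs ds); rewrite /= nonzero_mul_colour dxy eqxx.
Qed.

End CompletenessAb.

Theorem proposition5p5 :
  finitely_based Sc_a /\
  finitely_based Sc_ab /\
  relative_basis comm_ai_semiring_laws Sc_ab
    (let x := Var 0 in let y := Var 1 in let z := Var 2 in let t := Var 3 in
     [:: x ⪯ x * y;
         y ⪯ x * x;
         t ⪯ x * y * z;
         x * t ⪯ x * y + y * z + z * t]).
Proof.
have complete_ab := complete_of_nonzero Sc_ab_basis_laws le_Sc_ab.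
split; first exact: Sc_a_finitely_based.
split; last by split; [exact: Sc_ab_axioms_sound|exact: complete_ab].
exists Sc_ab_basis; split; last exact: complete_ab.
move=> e /In_cat[]; [exact: Sc_comm_ai_semiring|exact: Sc_ab_axioms_sound].
Qed.
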